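(* Let $\mathcal{V}_1$ and $\mathcal{V}_2$ be two varieties in $\mathbb{C}^d$ and let $p_1,p_2\in\mathbb{C}[x_1,\dotsc,x_d]$. Then there exists a polynomial $f\in\mathbb{C}[x_1,\dotsc,x_d]$ such that $f|_{\mathcal{V}_k}=p_k|_{\mathcal{V}_k}$ for $k=1,2$ if and only if $\lambda(p_1)=\lambda(p_2)$ for every $\lambda\in\left[J(\mathcal{V}_1)+J(\mathcal{V}_2)\right]^{\bot}$. Moreover, in this case any polynomial $f$ satisfying $f|_{\mathcal{V}_k}=p_k|_{\mathcal{V}_k}$ for $k=1,2$ also satisfies $\lambda(f)=\lambda(p_1)=\lambda(p_2)$ for every $\lambda\in\left[J(\mathcal{V}_1)+J(\mathcal{V}_2)\right]^{\bot}$.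
   Context: A variety in $\mathbb{C}^d$ is a set of the form $\{\mathbf{x}\in\mathbb{C}^d: p(\mathbf{x})=0 \text{ for all } p\in J\}$ for some ideal $J\subset\mathbb{C}[x_1,\dotsc,x_d]$. For a variety $\mathcal{V}$, $J(\mathcal{V})=\{f\in\mathbb{C}[x_1,\dotsc,x_d]: f(\mathbf{x})=0\text{ for all }\mathbf{x}\in\mathcal{V}\}$. For a linear subspace $A\subset\mathbb{C}[x_1,\dotsc,x_d]$, $A^{\bot}$ denotes its annihilator: the set of all linear functionals $\lambda:\mathbb{C}[x_1,\dotsc,x_d]\to\mathbb{C}$ (elements of the algebraic dual) with $\lambda(g)=0$ for all $g\in A$. *)

(* Defs.v *)
From HB Require Import structures.
From mathcomp Require Import all_boot all_order all_algebra.
From mathcomp Require Import boolp classical_sets reals.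
From mathcomp Require Import complex mpoly.

Set Implicit Arguments.
Unset Strict Implicit.
Unset Printing Implicit Defensive.

Import GRing.Theory.
Local Open Scope ring_scope.
Local Open Scope classical_set_scope.

Section AffineVarieties.
Variables (d : nat) (K : fieldType).
Implicit Types (I A B : set {mpoly K[d]}) (V : set 'rV[K]_d).

(* The whole ring counts as an ideal, so the empty set is a variety; the
   library's [idealr_closed] excludes it. *)
Definition is_ideal I : Prop :=
  I 0 /\ forall a f g, I f -> I g -> I (a * f + g).

Definition zero_locus I : set 'rV[K]_d :=
  [set x | forall f, I f -> f.@[x 0] = 0].

Definition is_variety V : Prop :=
  exists2 I, is_ideal I & V = zero_locus I.

Definition vanishing_ideal V : set {mpoly K[d]} :=
  [set f | forall x, V x -> f.@[x 0] = 0].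

Definition sum_set A B : set {mpoly K[d]} := [set f + g | f in A & g in B].

Definition annihilator A : set {scalar {mpoly K[d]}} :=
  [set l | forall g, A g -> l g = 0].

Definition agree_on V (f p : {mpoly K[d]}) : Prop :=
  forall x, V x -> f.@[x 0] = p.@[x 0].

End AffineVarieties.

(* Main.v *)
(* Linear functionals separate points from subspaces (Zorn), so every functional
   in [J(V1) + J(V2)]^\bot kills p1 - p2 exactly when p1 - p2 = g + h with g in
   J(V1) and h in J(V2); then f = p1 - g = p2 + h interpolates. *)
Require Import Defs.
From HB Require Import structures.
From mathcomp Require Import all_boot all_order all_algebra.
From mathcomp Require Import boolp classical_sets reals.
From mathcomp Require Import complex mpoly.

Set Implicit Arguments.
Unset Strict Implicit.
Unset Printing Implicit Defensive.

Import GRing.Theory.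
Local Open Scope ring_scope.
Local Open Scope classical_set_scope.

Section SeparatingFunctionals.
Variables (K : fieldType) (V : lmodType K).
Implicit Types (W M : set V) (u v : V).

Definition is_subspace W : Prop :=
  W 0 /\ forall a u v, W u -> W v -> W (a *: u + v).

Lemma is_subspaceZ W a u : is_subspace W -> W u -> W (a *: u).
Proof. by move=> [W0 Wlin] Wu; rewrite -[_ *: _]addr0; exact: Wlin. Qed.

Lemma is_subspaceB W u v : is_subspace W -> W u -> W v -> W (u - v).
Proof.
by move=> [_ Wlin] Wu Wv; rewrite addrC -scaleN1r; exact: Wlin.
Qed.

Lemma maximal_subspace_avoiding W v : is_subspace W -> ~ W v ->
  exists M, [/\ is_subspace M, W `<=` M, ~ M v &
    forall M', is_subspace M' -> M `<=` M' -> ~ M' v -> M' `<=` M].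
Proof.
move=> [W0 Wlin] Wv.
(* [Zorn_bigcup] also requires the union of the empty chain to be admissible,
   so Zorn's lemma is applied to the sets that become suitable once [W] is
   adjoined. *)
pose P (A : set V) := is_subspace (A `|` W) /\ ~ (A `|` W) v.
have [F FP totF|A [[subA Av] maxA]] := @Zorn_bigcup V P.
  have sub X : F X -> X `|` W `<=` \bigcup_(X in F) X `|` W.
    by move=> FX; apply: setSU; exact: bigcup_sup.
  split; last by move=> [[X FX Xv]|//]; apply: (FP _ FX).2; left.
  split=> [|a x y]; first by right.
  (* It is enough to find a single member of the chain whose union with [W] contains both vectors.
     When they come from two members, totality of the chain makes the larger one do. *)
  have lin X : F X -> (X `|` W) x -> (X `|` W) y ->
      (\bigcup_(X in F) X `|` W) (a *: x + y).
    by move=> FX Xx Xy; apply: (sub X FX); exact: (FP _ FX).1.2.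
  case=> [[X FX Xx]|Wx] [[Y FY Yy]|Wy]; last by right; exact: Wlin.
  - by case: (totF _ _ FX FY) => [XY|YX];
      [apply: (lin Y FY); left => //; exact: XY
      |apply: (lin X FX); left => //; exact: YX].
  - by apply: (lin X FX); [left|right].
  - by apply: (lin Y FY); [right|left].
exists (A `|` W); split=> // M' subM' AM' M'v x M'x; left.
have WM' : M' `|` W = M' by apply/setUidPl => z Wz; apply: AM'; right.
(* Otherwise [M'] would be a strictly larger set than [A] satisfying [P], since adjoining [W] leaves
   [M'] unchanged. *)
apply: contrapT => Ax; apply: (maxA M').
  by split=> [|/(_ _ M'x)//]; exact: subset_trans (@subsetUl _ _ _) AM'.
by rewrite /P WM'.
Qed.

Lemma exists_separating_functional W v : is_subspace W -> ~ W v ->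
  exists2 l : {scalar V}, forall w, W w -> l w = 0 & l v != 0.
Proof.
move=> subW Wv.
have [M [subM WM Mv maxM]] := maximal_subspace_avoiding subW Wv.
(* By maximality [M] is a hyperplane with complement the line through [v]; the
   functional is the coordinate along that line. *)
have decomp u : exists c, M (u - c *: v).
  apply: contrapT => ncu.
  (* [M'] is [M] plus the line through [u]. If it contained [v], the relation [M (v - c *: u)] with
     [c != 0] could be solved for [u]; so it avoids [v], and maximality puts [u] in [M]. *)
  pose M' : set V := [set x | exists c, M (x - c *: u)].
  have Mu : M u.
    apply: (maxM M').
    - split=> [|a x y [c Mc] [e Me]].
        by exists 0; rewrite scale0r subr0; exact: subM.1.
      exists (a * c + e); rewrite scalerDl -scalerA.
      by rewrite opprD addrACA -scalerBr; exact: subM.2.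
    - by move=> x Mx; exists 0; rewrite scale0r subr0.
    - move=> [c Mc]; have [c0|c0] := eqVneq c 0.
        by apply: Mv; rewrite c0 scale0r subr0 in Mc.
      apply: ncu; exists c^-1; rewrite -[u](scalerK c0) -scalerBr.
      by rewrite -opprB scalerN -scaleNr; exact: is_subspaceZ.
    - by exists 1; rewrite scale1r subrr; exact: subM.1.
  by apply: ncu; exists 0; rewrite scale0r subr0.
(* Two distinct coordinates would put a nonzero multiple of [v] in [M]. *)
have coord_unique u a b : M (u - a *: v) -> M (u - b *: v) -> a = b.
  move=> Ma Mb; apply: contrapT => /eqP; rewrite -subr_eq0 => ab.
  apply: Mv; rewrite -[v](scalerK ab); apply: is_subspaceZ => //.
  have -> : (a - b) *: v = (u - b *: v) - (u - a *: v).
    by rewrite opprB [RHS]addrC addrA subrK scalerBl.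
  exact: is_subspaceB.
have [l lP] := choice decomp.
(* Uniqueness of coordinates makes the chosen function linear. *)
have lin : linear_for *%R l.
  move=> a x y; apply: (coord_unique (a *: x + y)) => //.
  rewrite scalerDl -scalerA opprD addrACA -scalerBr.
  exact: subM.2.
pose linM := GRing.isLinear.Build K V K *%R l lin.
pose L : {scalar V} := HB.pack l linM.
exists L => [w Ww|].
  by apply: (coord_unique w) => //; rewrite scale0r subr0; exact: WM.
suff -> : L v = 1 by exact: oner_neq0.
by apply: (coord_unique v) => //; rewrite scale1r subrr; exact: subM.1.
Qed.

End SeparatingFunctionals.

Section VanishingIdeals.
Variables (d : nat) (K : fieldType).
Implicit Types (V : set 'rV[K]_d) (f g p : {mpoly K[d]}).

(** Turns interpolation conditions into memberships that linear functionals can test. *)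
Lemma agree_on_vanishing_ideal V f p :
  agree_on V f p <-> vanishing_ideal V (f - p).
Proof.
split=> H x Vx; first by rewrite mevalB H // subrr.
by apply/eqP; rewrite -subr_eq0 -mevalB H.
Qed.

Lemma vanishing_ideal_subspace V : is_subspace (vanishing_ideal V).
Proof.
split=> [x _|a f g If Ig x Vx]; first exact: meval0.
by rewrite mevalD mevalZ If // Ig // mulr0 addr0.
Qed.

Lemma sum_set_subspace (A B : set {mpoly K[d]}) :
  is_subspace A -> is_subspace B -> is_subspace (sum_set A B).
Proof.
move=> [A0 Alin] [B0 Blin]; split=> [|a _ _ [f Af [g Bg <-]] [h Ah [k Bk <-]]].
  by exists 0 => //; exists 0 => //; rewrite addr0.
exists (a *: f + h); first exact: Alin.
by exists (a *: g + k); [exact: Blin|rewrite scalerDr addrACA].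
Qed.

Lemma annihilator_sum_set (A B : set {mpoly K[d]}) (l : {scalar {mpoly K[d]}}) :
  A 0 -> B 0 -> annihilator (sum_set A B) l -> annihilator A l /\ annihilator B l.
Proof.
move=> A0 B0 Nl; split=> g Hg; apply: Nl.
  by exists g => //; exists 0 => //; rewrite addr0.
by exists 0 => //; exists g => //; rewrite add0r.
Qed.

End VanishingIdeals.

Theorem lemma2p6 (R : realType) (d : nat) (V1 V2 : set 'rV[R[i]]_d)
    (hV1 : is_variety V1) (hV2 : is_variety V2) (p1 p2 : {mpoly R[i][d]}) :
  let N := annihilator (sum_set (vanishing_ideal V1) (vanishing_ideal V2)) in
  ((exists f : {mpoly R[i][d]}, agree_on V1 f p1 /\ agree_on V2 f p2)
     <-> (forall l : {scalar {mpoly R[i][d]}}, N l -> l p1 = l p2))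
  /\ (forall f : {mpoly R[i][d]}, agree_on V1 f p1 -> agree_on V2 f p2 ->
        forall l : {scalar {mpoly R[i][d]}}, N l -> l f = l p1 /\ l p1 = l p2).
Proof.
move=> N.
have sub1 := vanishing_ideal_subspace V1.
have sub2 := vanishing_ideal_subspace V2.
(* This serves both the forward implication and the final clause: [l] kills each [f - p_k], which
   lies in the vanishing ideal of [V_k]. *)
have common f l : agree_on V1 f p1 -> agree_on V2 f p2 -> N l ->
    l f = l p1 /\ l f = l p2.
  move=> /agree_on_vanishing_ideal f1 /agree_on_vanishing_ideal f2 Nl.
  have [N1 N2] := annihilator_sum_set sub1.1 sub2.1 Nl.
  by split; apply/eqP; rewrite -subr_eq0 -linearB; apply/eqP;
    [exact: N1|exact: N2].
split; last by move=> f f1 f2 l Nl; have [<- <-] := common f l f1 f2 Nl.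
split=> [[f [f1 f2]] l Nl|Heq].
  by have [<- <-] := common f l f1 f2 Nl.
have [g J1g [h J2h gh]] :
    sum_set (vanishing_ideal V1) (vanishing_ideal V2) (p1 - p2).
  apply: contrapT => /(exists_separating_functional (sum_set_subspace sub1 sub2)).
  by case=> l Nl /eqP; apply; rewrite linearB (Heq l Nl) subrr.
(* Here [f - p1 = - g] and [f - p2 = h]. *)
exists (p1 - g); split; apply/agree_on_vanishing_ideal.
  by rewrite addrAC subrr; exact: is_subspaceB sub1 sub1.1 J1g.
by rewrite addrAC -gh addrC addKr.
Qed.
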